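(* Let $B$ and $B'$ be two $0$-$1$ stationary simple Bratteli diagrams with edge sets $E$ and $E'$, and let $\{\sigma_e:e\in E\}$ and $\{\sigma'_{e'}:e'\in E'\}$ be the corresponding semibranching function systems defined on $(X_B,m)$ and $(X_{B'},m')$, where each of $m$, $m'$ is the tail-invariant probability measure, a stationary Markov measure, or a quasi-stationary Markov measure on the respective path space. Suppose that $\alpha:E\to E'$ is an admissible map and $\overline\alpha:X_B\to X_{B'}$ is the one-to-one transformation generated by $\alpha$. Then $\overline\alpha$ implements an isomorphism of $\{\sigma_e:e\in E\}$ and $\{\sigma'_{\alpha(e)}:e\in E\}$ if and only if at least one of the following conditions holds: (1) $m=\mu$ and $m'=\mu'$, where $\mu$ and $\mu'$ are the probability measures invariant with respect to the tail equivalence relations $\mathcal R$ and $\mathcal R'$ respectively, and $\mu'\circ\overline\alpha=\mu$; (2) $m=\nu(P)$ and $m'=\nu'(P')$ are stationary Markov measures satisfying $p'_{s(\alpha(e)),\alpha(e)}=p_{s(e),e}$ for all $e\in E$; (3) $m=m(P_n)$ and $m'=m'(P'_n)$ are Markov measures satisfying $$0<\prod_{i=1}^\infty\frac{(p')^{(i)}_{s(\alpha(x_i)),\alpha(x_i)}}{p^{(i)}_{s(x_i),x_i}}<\infty$$ for any $x=(x_i)\in X_B$ (up to a set of $m$-measure zero).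
   Context: All relations between sets, maps and functions on a measure space are understood modulo sets of measure zero. $0$-$1$ stationary simple Bratteli diagram. $V$ is a finite set, $A=(a_{i,j})_{i,j\in V}$ is a primitive $0$-$1$ matrix, and $E$ is the set of edges: there is exactly one edge $e\in E$ with source $s(e)=i$ and range $r(e)=j$ if $a_{i,j}=1$, and none otherwise. The diagram $B$ has top level $V_0=\{v_0\}$, all levels $V_n$ ($n\ge1$) are copies of $V$, there is exactly one edge from $v_0$ to each vertex of $V_1$, and the edges between $V_n$ and $V_{n+1}$ ($n\ge1$) are a copy of $E$. $X_B$ is the set of infinite paths $x=(x_0,x_1,x_2,\ldots)$, $x_0$ an edge from $v_0$, $x_i\in E$ for $i\ge1$, with $r(x_i)=s(x_{i+1})$ for all $i\geq 0$; its topology is generated by the cylinder sets $[(e_0,\ldots,e_n)]=\{x:x_i=e_i,\ 0\le i\le n\}$ and $X_B$ is assumed to be a Cantor set. All measures are assumed Borel and non-atomic. Primed objects refer to $B'$. Tail-invariant measure: a measure on $X_B$ is invariant with respect to tail equivalence $\mathcal R$ if any two cylinder sets of the same length ending at the same vertex have equal measure. There is a unique such probability measure $\mu$: $\mu([(e_0,\ldots,e_n)])=\mathbf x_{r(e_n)}\lambda^{-n}$, where $\lambda$ is the Perron-Frobenius eigenvalue of $A$, $A\mathbf x=\lambda\mathbf x$, $\mathbf x>0$, $\sum_i\mathbf x_i=1$. Markov measure: given $P_0=(p^{(0)}_{v_0,e})$ indexed by edges $e$ from $v_0$ and matrices $P_n=(p^{(n)}_{v,e})_{v\in V,e\in E}$,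 $n\ge1$, with $p^{(n)}_{v,e}>0\iff s(e)=v$ and $\sum_{e:s(e)=v}p^{(n)}_{v,e}=1$ for all $v$ (for all $n\ge0$), the Markov measure $m(P_n)$ is given by $m([(e_0,\ldots,e_n)])=p^{(0)}_{v_0,e_0}p^{(1)}_{s(e_1),e_1}\cdots p^{(n)}_{s(e_n),e_n}$. It is stationary, written $\nu(P)$, if $P_n=P=(p_{v,e})$ for all $n\ge1$. It is quasi-stationary if $0<\prod_{i=1}^\infty p^{(i+1)}_{s(x_i),x_i}/p^{(i)}_{s(x_i),x_i}<\infty$ for every $x\in X_B$. The system on $X_B$: for $e\in E$, $D_e=\{y\in X_B:s(y_1)=r(e)\}$, $R_e=\{y\in X_B:y_1=e\}$, $\sigma_e:D_e\to R_e$, $\sigma_e(y)=(y'_0,e,y_1,y_2,\ldots)$ with $y'_0$ the edge from $v_0$ to $s(e)$; the coding map is $\sigma(x)=(z'_0,x_2,x_3,\ldots)$ with $z'_0$ the edge from $v_0$ to $s(x_2)$. For $m$ as in the claim this is a semibranching function system on $(X_B,m)$ with $D_e=\bigcup_{f:s(f)=r(e)}R_f$. Admissible map: a bijection $\alpha:E\to E'$ such that for all $e,f\in E$: $r(e)=s(f)\iff r(\alpha(e))=s(\alpha(f))$. It generates $\overline\alpha:X_B\to X_{B'}$, $\overline\alpha(x)=(y_0,\alpha(x_1),\alpha(x_2),\ldots)$ with $y_0$ the edge of $B'$ from $v_0$ to $s(\alpha(x_1))$. ''$\overline\alpha$ implements an isomorphism of $\{\sigma_e\}$ and $\{\sigma'_{\alpha(e)}\}$''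 means that for all $e\in E$, with $\varphi_e:=\overline\alpha|_{R_e}$: (a) $\varphi_e:R_e\to R'_{\alpha(e)}$ is one-to-one and onto; (b) $m'\circ\varphi_e$ is equivalent to $m|_{R_e}$ on $R_e$; (c) $\overline\alpha$ maps $D_e$ to $D'_{\alpha(e)}$ and $\overline\alpha\circ\sigma_e(x)=\sigma'_{\alpha(e)}\circ\overline\alpha(x)$ for $x\in D_e$. *)

(* Defs.v *)
From HB Require Import structures.
From mathcomp Require Import all_boot all_order all_algebra.
From mathcomp Require Import all_classical all_reals all_analysis.

Set Implicit Arguments.
Unset Strict Implicit.
Unset Printing Implicit Defensive.

Import Order.TTheory GRing.Theory Num.Theory.
Import numFieldNormedType.Exports.

Local Open Scope classical_set_scope.
Local Open Scope ring_scope.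

(* A 0-1 matrix indexed by a finite set V is given by a boolean relation
   a : rel V; an edge is a pair (i, j) with a i j. *)

Definition incidence_mx (V : finType) (a : rel V) : 'M[nat]_#|V| :=
  \matrix_(i, j) nat_of_bool (a (enum_val i) (enum_val j)).

Definition primitive_mx (n : nat) (M : 'M[nat]_n) : Prop :=
  exists2 k : nat, (0 < k)%N & forall i j, (0 < (M ^+ k) i j)%N.

Section PathSpace.
Variables (V : finType) (a : rel V).

Definition edge := {p : V * V | a p.1 p.2}.
HB.instance Definition _ := Finite.on edge.

Definition src (e : edge) : V := (val e).1.
Definition rng (e : edge) : V := (val e).2.

(* An infinite path (x_0, x_1, x_2, ...).  The edge x_0 is identified with its
   range in V, there being exactly one edge from v_0 to each vertex of V_1;
   the second component is the shifted sequence n |-> x_(n+1). *)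
Definition is_path (x : V * (nat -> edge)) : Prop :=
  x.1 = src (x.2 0%N) /\ forall n, rng (x.2 n) = src (x.2 n.+1).

Definition path_space := {x : V * (nat -> edge) | is_path x}.

Definition top_edge (x : path_space) : V := (sval x).1.
Definition edges (x : path_space) : nat -> edge := (sval x).2.

(* The word w continues a finite path that has reached the vertex v. *)
Fixpoint fin_path (v : V) (w : seq edge) : bool :=
  if w is e :: w' then (src e == v) && fin_path (rng e) w' else true.

Definition end_vertex (e0 : V) (w : seq edge) : V := last e0 (map rng w).

(* [(e_0, e_1, ..., e_n)], where w = (e_1, ..., e_n) *)
Definition cylinder (n : nat) (e0 : V) (w : n.-tuple edge) : set path_space :=
  [set x | top_edge x = e0 /\ forall i : 'I_n, edges x i = tnth w i].

Definition cylinders : set (set path_space) :=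
  [set C | exists n (e0 : V) (w : n.-tuple edge),
     fin_path e0 w /\ C = cylinder e0 w].

HB.instance Definition _ := gen_eqMixin path_space.
HB.instance Definition _ := gen_choiceMixin path_space.
HB.instance Definition _ :=
  @isSubBaseTopological.Build path_space (set path_space) cylinders id.

End PathSpace.

Definition is_cantor_set (T : topologicalType) : Prop :=
  exists (f : cantor_space -> T) (g : T -> cantor_space),
    [/\ cancel f g, cancel g f, continuous f & continuous g].

(* 0-1 stationary simple Bratteli diagrams whose path space is a Cantor set *)
Record bratteli := Bratteli {
  vertex : finType;
  adj : rel vertex;
  adj_primitive : primitive_mx (incidence_mx adj);
  adj_cantor : is_cantor_set (path_space adj)
}.

Definition E (B : bratteli) := edge (@adj B).
HB.instance Definition _ (B : bratteli) := Finite.on (E B).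

Definition X (B : bratteli) := path_space (@adj B).
HB.instance Definition _ (B : bratteli) := Topological.on (X B).

(* measurable types are pointed in the library *)
Definition X_point (B : bratteli) : X B :=
  sval (cid (adj_cantor B)) point.
HB.instance Definition _ (B : bratteli) := isPointed.Build (X B) (X_point B).

Definition borel (B : bratteli) : set (set (X B)) := [set A : set (X B) | open A].
HB.instance Definition _ (B : bratteli) :=
  Measurable.copy (X B) (g_sigma_algebraType (@borel B)).

Section Measures.
Context {R : realType} {B : bratteli}.
Implicit Type m : probability (X B) R.

Definition non_atomic m : Prop :=
  forall A : set (X B), measurable A -> (0 < m A)%E ->
    exists C : set (X B), [/\ measurable C, C `<=` A, (0 < m C)%E & (m C < m A)%E].

Definition tail_invariant m : Prop :=
  forall n (e0 f0 : vertex B) (w u : n.-tuple (E B)),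
    fin_path e0 w -> fin_path f0 u -> end_vertex e0 w = end_vertex f0 u ->
    m (cylinder e0 w) = m (cylinder f0 u).

Definition initial_distribution (P0 : vertex B -> R) : Prop :=
  (forall v, 0 < P0 v) /\ \sum_v P0 v = 1.

Definition transition_matrix (p : vertex B -> E B -> R) : Prop :=
  [/\ forall v e, 0 <= p v e,
      forall v e, 0 < p v e <-> src e = v &
      forall v, \sum_(e : E B | src e == v) p v e = 1].

(* m = m(P_n), where P0 is the paper's P_0 and P n stands for P_(n+1), n >= 0,
   in accordance with the shift in [edges] *)
Definition is_markov m (P0 : vertex B -> R) (P : nat -> vertex B -> E B -> R) :
    Prop :=
  [/\ initial_distribution P0,
      forall n, transition_matrix (P n) &
      forall n (e0 : vertex B) (w : n.-tuple (E B)), fin_path e0 w ->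
        m (cylinder e0 w) =
        (P0 e0 * \prod_(i < n) P i (src (tnth w i)) (tnth w i))%:E].

Definition is_stationary_markov m (P0 : vertex B -> R)
    (p : vertex B -> E B -> R) : Prop :=
  is_markov m P0 (fun=> p).

End Measures.

(* 0 < \prod_(i >= 0) u i < oo *)
Definition inf_prod_pos {R : realType} (u : nat -> R) : Prop :=
  exists2 l : R, 0 < l & (fun n => \prod_(i < n) u i) @ \oo --> l.

Section Kinds.
Context {R : realType} {B : bratteli}.
Implicit Type m : probability (X B) R.

Definition is_quasi_stationary_markov m (P0 : vertex B -> R)
    (P : nat -> vertex B -> E B -> R) : Prop :=
  is_markov m P0 P /\
  forall x : X B, inf_prod_pos (fun i =>
    P i.+1 (src (edges x i)) (edges x i) / P i (src (edges x i)) (edges x i)).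

Definition measure_in_claim m : Prop :=
  [\/ tail_invariant m,
      exists P0 p, is_stationary_markov m P0 p |
      exists P0 P, is_quasi_stationary_markov m P0 P].

End Kinds.

Section System.
Context {B : bratteli}.

Definition D (e : E B) : set (X B) := [set y | src (edges y 0) = rng e].
Definition Rg (e : E B) : set (X B) := [set y | edges y 0 = e].

Definition scons_edge (e : E B) (s : nat -> E B) (n : nat) : E B :=
  if n is k.+1 then s k else e.

Lemma sigma_subproof (e : E B) (y : X B) :
  D e y -> is_path (src e, scons_edge e (edges y)).
Proof. by move=> Dy; split=> // -[|n] //=; have [_ ->] := svalP y. Qed.

Definition sigma (e : E B) (y : X B) (Dy : D e y) : X B :=
  exist _ _ (sigma_subproof Dy).

End System.

Section Admissible.
Context {B B' : bratteli}.

Definition admissible (alpha : E B -> E B') : Prop :=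
  bijective alpha /\
  forall e f, rng e = src f <-> rng (alpha e) = src (alpha f).

Lemma induced_map_subproof (alpha : E B -> E B') (adm : admissible alpha) (x : X B) :
  is_path (src (alpha (edges x 0)), fun n => alpha (edges x n)).
Proof. by split=> //= n; apply/(adm.2 _ _); have [_ ->] := svalP x. Qed.

Definition induced_map (alpha : E B -> E B') (adm : admissible alpha) (x : X B) :
    X B' :=
  exist _ _ (induced_map_subproof adm x).

(* Clauses (a) and (c) are read up to null sets; in (c), [Dx'] is the membership
   of the image in D'_(alpha e), without which sigma'_(alpha e) does not apply. *)
Definition implements_isomorphism {R : realType}
    (m : probability (X B) R) (m' : probability (X B') R)
    (alpha : E B -> E B') (adm : admissible alpha) : Prop :=
  forall e : E B,
  [/\ exists N N',
        [/\ m.-negligible N, m'.-negligible N' &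
            set_bij (Rg e `\` N) (Rg (alpha e) `\` N') (induced_map adm)],
      forall A : set (X B), measurable A -> A `<=` Rg e ->
        (m' (induced_map adm @` A) = 0%E <-> m A = 0%E) &
      {ae m, forall x, forall Dx : D e x,
         exists Dx' : D (alpha e) (induced_map adm x),
           induced_map adm (sigma Dx) = sigma Dx'}].

End Admissible.

(* Main.v *)
(* An admissible map is an isomorphism of the underlying graphs, so the induced map is a
   homeomorphism conjugating the two systems, and the theorem is about mutual absolute
   continuity of m and the pull-back nu of m'.  Each of the measures allowed is a Markov
   measure with transition probabilities bounded away from 0 (for a quasi-stationary one,
   multiply the infinite products over the rotations of a cycle through a given edge).

   The partial products of (3) are, up to a factor depending on the first vertex only, the
   ratios nu(C_n(x)) / m(C_n(x)) for the cylinders C_n(x) around x.  If m << nu, these ratios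
   converge m-a.e. in (0, oo): cylinders are nested, so a covering argument compares m
   and nu on the sets where the ratios oscillate, are unbounded, or approach 0.
   Conversely, (3) puts m-almost every x in the set H where the ratios are
   eventually bounded above and below.  On H the two measures are equivalent, so
   nu(H) > 0; and H is a tail set, so nu(H) = 1 by the zero-one law.  Condition (2) is
   the case of (3) where all factors equal 1. *)

Require Import Defs.
From HB Require Import structures.
From mathcomp Require Import all_boot all_order all_algebra finmap.
From mathcomp Require Import all_classical all_reals all_analysis ring.

Set Implicit Arguments.
Unset Strict Implicit.
Unset Printing Implicit Defensive.

Import Order.TTheory GRing.Theory Num.Theory.
Import numFieldNormedType.Exports.

Local Open Scope classical_set_scope.
Local Open Scope ring_scope.

Section Paths.
Context {B : bratteli}.
Implicit Types (x y z : X B) (v w : vertex B) (e f : E B).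

Lemma top_edgeE x : top_edge x = src (edges x 0).
Proof. by have [] := svalP x. Qed.

Lemma edges_step x n : rng (edges x n) = src (edges x n.+1).
Proof. by have [_ ->] := svalP x. Qed.

Lemma edges_inj x y : (forall n, edges x n = edges y n) -> x = y.
Proof.
move: x y => [[xt xe] xP] [[yt ye] yP]; rewrite /edges /= => /funext xy.
have tE : xt = yt by rewrite [xt]xP.1 [yt]yP.1 /= xy.
move: xP yP; rewrite tE xy => xP yP.
by congr exist; exact: Prop_irrelevance.
Qed.

Lemma incidence_expP (k : nat) (i j : 'I_#|vertex B|) :
  (0 < (incidence_mx (@adj B) ^+ k) i j)%N ->
  exists s : seq (E B), [/\ size s = k, fin_path (enum_val i) s &
    end_vertex (enum_val i) s = enum_val j].
Proof.
elim: k i => [|k IHk] i.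
  rewrite expr0 mxE; case: eqP => [->|//] _.
  by exists [::].
rewrite exprS mxE lt0n sum_nat_eq0 negb_forall => /existsP[l].
rewrite /= -lt0n muln_gt0 => /andP[+ /IHk[s [ss sp se]]].
rewrite mxE lt0b => ail.
exists (exist _ (enum_val i, enum_val l) ail :: s); split => //=.
- by rewrite ss.
- by rewrite eqxx.
Qed.

Lemma walkP : exists2 k, (0 < k)%N & forall v w, exists s : seq (E B),
  [/\ size s = k, fin_path v s & end_vertex v s = w].
Proof.
have [k k0 kP] := adj_primitive B; exists k => // v w.
have [s] := incidence_expP (kP (enum_rank v) (enum_rank w)).
by rewrite !enum_rankK; exists s.
Qed.

Lemma src_surj v : exists e, src e = v.
Proof.
have [k k0 /(_ v v)[[|e s] [sk]]] := walkP; first by move: k0; rewrite -sk.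
by move=> /= /andP[/eqP <-] _ _; exists e.
Qed.

Lemma rng_surj v : exists e, rng e = v.
Proof.
have [k k0 /(_ v v)[s []]] := walkP.
case/lastP: s => [sk|s e _ _]; first by move: k0; rewrite -sk.
by rewrite /end_vertex map_rcons last_rcons; exists e.
Qed.

Lemma path_from v : exists x, src (edges x 0) = v.
Proof.
have [nxt nxtP] := choice src_surj.
pose s := fix s n := if n is m.+1 then nxt (rng (s m)) else nxt v.
have sP : is_path (src (s 0%N), s) by split => // n; rewrite /= nxtP.
by exists (exist _ _ sP); rewrite /edges /= nxtP.
Qed.

Lemma prepend_word v (s : seq (E B)) y :
  fin_path v s -> end_vertex v s = src (edges y 0) ->
  exists x, [/\ src (edges x 0) = v,
    forall d i, (i < size s)%N -> edges x i = nth d s i &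
    forall i, edges x (size s + i) = edges y i].
Proof.
elim: s v => [|e s IHs] v /=; first by move=> _ vy; exists y.
case/andP=> /eqP <- /IHs{}IHs /IHs[x [xs xw xy]].
exists (sigma (xs : D e x)); split => //.
by move=> d [|i] //= i_s; exact: xw.
Qed.

Lemma path_through n v : exists x, src (edges x n) = v.
Proof.
elim: n v => [|n IHn] v; first exact: path_from.
have [e <-] := rng_surj v; have [x xe] := IHn (src e).
have [z ze] := path_from (rng e).
have seP : is_path (top_edge x, fun i => if (i < n)%N then edges x i else
    scons_edge e (edges z) (i - n)).
  split=> /= [|i].
    case: n {IHn} xe => [|n] xe /=; last exact: top_edgeE.
    by rewrite -xe top_edgeE.
  case: (ltngtP i.+1 n) => [lt|lt|ni].
  - by rewrite edges_step.
  - rewrite subSn//=; case: (i - n)%N => [|j] /=.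
      by rewrite ze.
    exact: edges_step.
  - by rewrite ni subnn /= -xe -ni edges_step.
by exists (exist _ _ seP); rewrite /edges /= ltnNge leqnSn /= subSn ?leqnn// subnn.
Qed.

Definition splice_edges (n : nat) x y (i : nat) : E B :=
  if (i < n)%N then edges x i else edges y i.

Lemma splice_is_path n x y : src (edges x n) = src (edges y n) ->
  is_path (src (splice_edges n x y 0), splice_edges n x y).
Proof.
rewrite /splice_edges => xy; split=> //= i.
case: (ltngtP i.+1 n) => [lt|lt|ni].
- by rewrite edges_step ?ni.
- by rewrite edges_step ?ni.
- by rewrite edges_step ?ni.
Qed.

Lemma splice n x y : src (edges x n) = src (edges y n) ->
  exists z, (forall i, (i < n)%N -> edges z i = edges x i) /\
            (forall i, (n <= i)%N -> edges z i = edges y i).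
Proof.
move=> xy; exists (exist _ _ (splice_is_path xy)).
rewrite /edges /=.
by split=> i ni; rewrite /splice_edges ?ni// ltnNge ni.
Qed.

(* [cyl n x] also records the top edge, so that [cyl 0 x] is not the whole space *)
Definition cyl n x : set (X B) :=
  cylinder (top_edge x) [tuple edges x i | i < n].

Lemma cylE n x y : cyl n x y <->
  top_edge y = top_edge x /\ forall i, (i < n)%N -> edges y i = edges x i.
Proof.
split=> -[yt ye]; split=> //.
  by move=> i lti; have := ye (Ordinal lti); rewrite tnth_mktuple.
by move=> i; rewrite tnth_mktuple ye.
Qed.

Lemma cyl_id n x : cyl n x x. Proof. exact/cylE. Qed.

Lemma cyl_sym n x y : cyl n x y -> cyl n y x.
Proof. by rewrite !cylE => -[-> xy]; split=> // i /xy. Qed.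

Lemma cyl_trans n x y z : cyl n x y -> cyl n y z -> cyl n x z.
Proof. by rewrite !cylE => -[<- xy] [-> yz]; split=> // i i_n; rewrite yz ?xy. Qed.

Lemma cyl_eq n x y : cyl n x y -> cyl n y = cyl n x.
Proof.
move=> xy; apply/seteqP; split=> z; first exact: cyl_trans.
exact/cyl_trans/cyl_sym.
Qed.

Lemma cyl_le n n' x : (n <= n')%N -> cyl n' x `<=` cyl n x.
Proof. by move=> nn y; rewrite !cylE => -[-> xy]; split=> // i /leq_trans/(_ nn)/xy. Qed.

Lemma cyl_src n x y : cyl n x y -> src (edges y n) = src (edges x n).
Proof.
rewrite cylE => -[txy xy]; case: n xy => [|n] xy; first by rewrite -!top_edgeE.
by rewrite -!edges_step xy.
Qed.

Lemma cyl_splice n x y : src (edges x n) = src (edges y n) ->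
  exists2 z, cyl n x z & forall i, (n <= i)%N -> edges z i = edges y i.
Proof.
move=> xy; have [z [zx zy]] := splice xy; exists z => //.
apply/cylE; split=> //; rewrite !top_edgeE; move: zx xy zy.
by case: n => [|n] zx xy zy; [rewrite xy zy|rewrite zx].
Qed.

Lemma cylSI n x y : cyl n.+1 x y <-> cyl n x y /\ edges y n = edges x n.
Proof.
rewrite !cylE; split=> [[-> xy]|[[-> xy] xyn]].
  by split; [split=> // i i_n; rewrite xy// ltnS ltnW|rewrite xy].
by split=> // i; rewrite ltnS leq_eqVlt => /orP[/eqP ->|/xy].
Qed.

Lemma cyl_walk n k x y : (forall v w, exists s : seq (E B),
    [/\ size s = k, fin_path v s & end_vertex v s = w]) ->
  exists2 z, cyl n x z & forall i, (n + k <= i)%N -> edges z i = edges y i.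
Proof.
move=> /(_ (src (edges x n)) (src (edges y (n + k))))[s [ss sp se]].
have y'P : is_path (src (edges y (n + k)), fun i => edges y (n + k + i)).
  by split=> [|i]; rewrite /= ?addn0// addnS edges_step.
have [u [u0 us uy]] : exists u, [/\ src (edges u 0) = src (edges x n),
    forall d i, (i < size s)%N -> edges u i = nth d s i &
    forall i, edges u (size s + i) = edges y (n + k + i)].
  by apply: (@prepend_word _ _ (exist _ _ y'P)); rewrite // /edges /= addn0.
have zP : is_path (top_edge x,
    fun i => if (i < n)%N then edges x i else edges u (i - n)).
  split=> /= [|i].
    by rewrite top_edgeE; case: ltnP => //; rewrite leqn0 => /eqP n0; rewrite sub0n u0 n0.
  case: (ltngtP i.+1 n) => [lt|lt|ni].
  - by rewrite edges_step.
  - by rewrite subSn// edges_step.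
  - by rewrite ni subnn u0 -ni edges_step.
exists (exist _ _ zP).
  by apply/cylE; split=> // i i_n; rewrite {1}/edges /= i_n.
move=> i nki; have ni : (n <= i)%N by apply: leq_trans nki; rewrite leq_addr.
rewrite {1}/edges /= ltnNge ni /=.
have -> : (i - n = size s + (i - (n + k)))%N by rewrite ss subnDA subnKC// leq_subRL.
by rewrite uy subnKC.
Qed.

Lemma fin_path_cyl n (w : n.-tuple (E B)) v : fin_path v w ->
  exists x, [/\ cylinder v w = cyl n x, src (edges x n) = end_vertex v w &
    src (edges x 0) = v].
Proof.
move=> wv; have [y ye] := path_from (end_vertex v w).
have [x [xv xw xy]] := prepend_word wv (esym ye).
exists x; split => //.
  congr (cylinder _ _); first by rewrite top_edgeE.
  apply/eq_from_tnth => i; rewrite tnth_mktuple.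
  rewrite (tnth_nth (tnth w i)) (xw (tnth w i)) ?size_tuple//.
by rewrite -ye -xy size_tuple addn0.
Qed.

Lemma cyl_fin_path n x : fin_path (top_edge x) [tuple edges x i | i < n] /\
  end_vertex (top_edge x) [tuple edges x i | i < n] = src (edges x n).
Proof.
rewrite -[tval _]/(map _ _) /=.
have -> : [seq edges x (val i) | i <- enum 'I_n] = [seq edges x i | i <- iota 0 n].
  by rewrite -val_enum_ord -map_comp.
suff H k : fin_path (src (edges x k)) [seq edges x i | i <- iota k n] /\
  end_vertex (src (edges x k)) [seq edges x i | i <- iota k n] =
  src (edges x (k + n)) by rewrite top_edgeE; exact: H.
elim: n k => [|n IHn] k /=; first by rewrite addn0.
by rewrite /end_vertex /= eqxx edges_step addnS -addSn; exact: IHn.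
Qed.

Lemma cylinder_cyl n v (w : n.-tuple (E B)) x :
  cylinder v w x -> cylinder v w = cyl n x.
Proof.
move=> [<- xw]; congr cylinder; apply/eq_from_tnth => i.
by rewrite tnth_mktuple xw.
Qed.

Lemma open_cyl n x : open (cyl n x).
Proof.
exists [set cyl n x]; last by rewrite bigcup_set1.
move=> _ ->; exists [fset (cyl n x)]%fset => /=.
  move=> C /fset1P ->; rewrite inE.
  exists n, (top_edge x), [tuple edges x i | i < n]; split=> //.
  by have [] := cyl_fin_path n x.
by rewrite set_fset1 bigcap_set1.
Qed.

Lemma openP (U : set (X B)) :
  open U <-> forall x, U x -> exists n, cyl n x `<=` U.
Proof.
split=> [[DU DUsub <-] x [C DUC Cx]|HU].
  have [F Fsub FC] := DUsub _ DUC; subst C.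
  suff [n nP] : exists n, cyl n x `<=` \bigcap_(i in [set` F]) i.
    by exists n => y /nP yF; eexists; [exact: DUC|].
  have {}Fsub C : C \in (F : seq _) -> exists n, cyl n x `<=` C.
    move=> CF; have := Fsub _ CF; rewrite inE => -[n [v [w [_ CE]]]].
    exists n; rewrite CE (@cylinder_cyl _ _ _ x)// -CE.
    exact: Cx.
  have [n nP] : exists n, forall C, C \in (F : seq _) -> cyl n x `<=` C.
    elim: (F : seq _) Fsub => [|C s IHs] Fsub; first by exists 0%N.
    have [|n nP] := IHs; first by move=> D Ds; apply: Fsub; rewrite inE Ds orbT.
    have [n' n'P] := Fsub C (mem_head _ _).
    exists (maxn n n') => D; rewrite inE => /orP[/eqP ->|/nP DP].
      by apply: subset_trans n'P; apply: cyl_le; rewrite leq_maxr.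
    by apply: subset_trans DP; apply: cyl_le; rewrite leq_maxl.
  by exists n => y xy C /= /nP; exact.
have -> : U = \bigcup_(p in [set p : nat * X B | cyl p.1 p.2 `<=` U])
    cyl p.1 p.2.
  apply/seteqP; split=> [x /HU[n nP]|x [p /= pU /pU//]].
  by exists (n, x) => //; exact: cyl_id.
by apply: bigcup_open => p _; exact: open_cyl.
Qed.

Lemma measurable_open (U : set (X B)) : open U -> measurable U.
Proof. by move=> oU; exact: sub_sigma_algebra. Qed.

Definition saturated n (S : set (X B)) := forall x, S x -> cyl n x `<=` S.

Lemma saturatedC n S : saturated n S -> saturated n (~` S).
Proof. by move=> sS x Sx y /cyl_sym xy /sS Sy; exact/Sx/Sy. Qed.

Lemma saturated_open n S : saturated n S -> open S.
Proof. by move=> sS; apply/openP => x Sx; exists n; exact: sS. Qed.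

Lemma saturated_measurable n S : saturated n S -> measurable S.
Proof. by move=> /saturated_open/measurable_open. Qed.

Lemma measurable_cyl n x : measurable (cyl n x).
Proof. by apply: measurable_open; exact: open_cyl. Qed.

End Paths.

Section Covering.
Context {R : realType} {B : bratteli}.
Implicit Types (mu : {measure set (X B) -> \bar R}) (A S U V : set (X B)).

Lemma measure_tail_small mu (F : nat -> set (X B)) (eps : R) :
  (mu setT < +oo)%E -> (forall n, measurable (F n)) -> nonincreasing_seq F ->
  \bigcap_n F n = set0 -> 0 < eps -> exists n, (mu (F n) < eps%:E)%E.
Proof.
move=> muT mF niF F0 eps0.
have F0oo : (mu (F 0%N) < +oo)%E.
  by apply: le_lt_trans muT; apply: le_measure; rewrite ?inE.
have mcF : measurable (\bigcap_n F n) by rewrite F0.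
have := nonincreasing_cvg_mu F0oo mF mcF niF.
rewrite F0 measure0 => muF.
have [N _ NP] := muF (fun u => (u < eps%:E)%E)
  (@open_ereal_lt' _ (0%:E) (eps%:E) eps0).
by exists N; exact: (NP N (leqnn N)).
Qed.

Lemma measurable_approx mu A (eps : R) : (mu setT < +oo)%E -> measurable A ->
  0 < eps -> exists U V,
  [/\ open U, open V, A `<=` U, ~` A `<=` V & (mu (U `&` V) < eps%:E)%E].
Proof.
move=> muT mA.
pose approx A := forall eps : R, 0 < eps -> exists U V,
  [/\ open U, open V, A `<=` U, ~` A `<=` V & (mu (U `&` V) < eps%:E)%E].
suff sub : <<s @borel B>> `<=` approx by move/sub: mA; exact.
move=> {A mA eps}; apply: smallest_sub => [|A oA eps eps0]; last first.
  pose F n := A `\` [set x | cyl n x `<=` A].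
  have satF n : saturated n [set x | cyl n x `<=` A].
    by move=> x xA y /cyl_eq yx /=; rewrite yx.
  have [n nP] : exists n, (mu (F n) < eps%:E)%E.
    apply: measure_tail_small => //.
    - move=> n; apply: measurableD; first exact: measurable_open.
      exact: saturated_measurable (satF n).
    - move=> n n' nn; apply/subsetPset => x [Ax nAx]; split=> // xA.
      by apply: nAx; apply: subset_trans xA; exact: cyl_le.
    - apply/seteqP; split=> // x xF; have [Ax _] := xF 0%N I.
      have /openP/(_ _ Ax)[n nA] := oA.
      by have [] := xF n I.
  exists A, (~` [set x | cyl n x `<=` A]); split=> //.
  - exact: saturated_open (saturatedC (satF n)).
  - by move=> x nAx /= /(_ _ (cyl_id _ _)).
split.
- move=> eps eps0; exists set0, setT; split; [exact: open0|exact: openT| | | ] => //.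
  by rewrite set0I measure0 lte_fin.
- move=> A apA eps eps0; have [U [V [oU oV AU AV UV]]] := apA _ eps0.
  exists V, U; split=> //; rewrite ?setTD// ?setCK//.
  by rewrite setIC.
- move=> F apF eps eps0.
  have e4 : 0 < eps / 4 by rewrite divr_gt0.
  have eP n : 0 < eps / 4 / (2 ^ n.+1)%:R by rewrite divr_gt0// ltr0n expn_gt0.
  have /choice[UV UVP] : forall n, exists UV : set (X B) * set (X B),
    [/\ open UV.1, open UV.2, F n `<=` UV.1, ~` F n `<=` UV.2 &
    (mu (UV.1 `&` UV.2) < (eps / 4 / (2 ^ n.+1)%:R)%:E)%E].
    by move=> n; have [U [V ?]] := apF n _ (eP n); exists (U, V).
  pose U := \bigcup_n (UV n).1.
  have mU n : measurable (UV n).1 by apply: measurable_open; have [] := UVP n.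
  have mV n : measurable (UV n).2 by apply: measurable_open; have [] := UVP n.
  have oU : open U by apply: bigcup_open => n _; have [] := UVP n.
  have mUV : measurable (\bigcup_n ((UV n).1 `&` (UV n).2)).
    by apply: bigcupT_measurable => n; exact: measurableI.
  pose G n := U `\` \bigcup_(i < n) (UV i).1.
  have mG n : measurable (G n).
    apply: measurableD; first exact: measurable_open.
    by apply: bigcup_measurable => k _; exact: mU.
  have [n nP] : exists n, (mu (G n) < (eps / 4)%:E)%E.
    apply: measure_tail_small => //.
    - move=> n n' nn; apply/subsetPset => x [Ux nUx]; split=> // -[i /= i_n Ui].
      by apply: nUx; exists i => //=; exact: leq_trans nn.
    - apply/seteqP; split=> // x xG; have [[i _ Ui] _] := xG 0%N I.
      by have [_ []] := xG i.+1 I; exists i => /=.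
  have oV : open (\bigcap_(i < n) (UV i).2).
    rewrite bigcap_mkord; apply: big_ind => //; first exact: openT.
      exact: openI.
    by move=> i _; have [] := UVP i.
  exists U, (\bigcap_(i < n) (UV i).2); split=> //.
  - by apply: bigcup_sub => i _ x Fx; exists i => //; have [_ _ + _ _] := UVP i; exact.
  - move=> x nFx i i_n; have [_ _ _ + _] := UVP i; apply => Fi.
    by apply: nFx; exists i.
  apply: (@le_lt_trans _ _ (mu (G n `|` \bigcup_n ((UV n).1 `&` (UV n).2)))).
    apply: le_measure; rewrite ?inE.
    + apply: measurableI; first exact: measurable_open.
      exact: measurable_open.
    + exact: measurableU.
    + move=> x [Ux Vx]; have [[i /= i_n Ui]|nUx] :=
          pselect ((\bigcup_(i < n) (UV i).1) x); [right|by left].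
      by exists i => //; split=> //; exact: Vx.
  apply: le_lt_trans (measureU2 _ (mG n) mUV) _.
  have -> : eps%:E = ((eps / 4)%:E + (eps / 4 * 3)%:E)%E.
    by rewrite -EFinD; congr EFin; rewrite -[X in X + _]mulr1 -mulrDr -[1 + 3]/4%:R divfK.
  apply: lteD => //.
  apply: (@le_lt_trans _ _ (eps / 4)%:E); last first.
    by rewrite lte_fin ltr_pMr// ltr1n.
  apply: le_trans (epsilon_trick0 predT (ltW e4)).
  apply: le_trans (generalized_Boole_inequality _ _ mUV) _.
    by move=> i; exact: measurableI.
  by apply: lee_nneseries => // i _; have [_ _ _ _ /ltW] := UVP i.
Qed.

Lemma saturated_le (mu1 mu2 : {measure set (X B) -> \bar R}) n S (a : R) :
  saturated n S ->
  (forall x, S x -> mu1 (cyl n x) <= a%:E * mu2 (cyl n x))%E ->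
  (mu1 S <= a%:E * mu2 S)%E.
Proof.
move=> satS leS.
pose P (p : vertex B * n.-tuple (E B)) := S `&` cylinder p.1 p.2.
have PE p x : P p x -> P p = cyl n x.
  move=> [Sx px]; rewrite /P (cylinder_cyl px); apply/setIidPr.
  exact: satS.
have mP p : measurable (P p).
  have [[x /PE ->]|P0] := pselect (P p !=set0); first exact: measurable_cyl.
  suff -> : P p = set0 by [].
  by apply/eqP; apply/negPn; apply/negP => /set0P.
have SE : S = \bigcup_p P p.
  apply/seteqP; split=> [x Sx|x [p _ []]//].
  by exists (top_edge x, [tuple edges x i | i < n]) => //; split=> //; exact: cyl_id.
have tP : trivIset setT P.
  move=> [v w] [v' w'] _ _ [x [[_ [/= <- xw]] [_ [/= <- xw']]]].
  by congr pair; apply/eq_from_tnth => i; rewrite -xw xw'.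
have fP : finite_set [set: vertex B * n.-tuple (E B)] by exact: finite_finset.
have muS mu : mu S = (\sum_(p \in setT) mu (P p))%E.
  by rewrite {1}SE measure_fin_bigcup.
have aS p : (mu1 (P p) <= a%:E * mu2 (P p))%E.
  have [[x xP]|P0] := pselect (P p !=set0).
    by rewrite (PE _ _ xP); apply: leS; case: xP.
  suff -> : P p = set0 by rewrite !measure0 mule0.
  by apply/eqP; apply/negPn; apply/negP => /set0P.
rewrite !muS ge0_mule_fsumr//.
exact: lee_fsum.
Qed.

(* The cylinders are nested, so the first good cylinders around the points of [A]
   form a disjoint cover; this replaces the martingale convergence theorem *)
Lemma covering_le (mu1 mu2 : {measure set (X B) -> \bar R}) A (a : R) :
  (mu2 setT < +oo)%E -> measurable A -> 0 <= a ->
  (forall x, A x -> forall N, exists2 n, (N <= n)%N &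
    (mu1 (cyl n x) <= a%:E * mu2 (cyl n x))%E) ->
  (mu1 A <= a%:E * mu2 A)%E.
Proof.
move=> mu2T mA a0 AP; apply/lee_addgt0Pr => e e0.
have e'0 : 0 < e / (a + 1) by rewrite divr_gt0// ltr_wpDl.
have [U [V [oU oV AU AV UV]]] := measurable_approx mu2T mA e'0.
pose G n := [set x | cyl n x `<=` U /\
  (mu1 (cyl n x) <= a%:E * mu2 (cyl n x))%E].
have satG n : saturated n (G n) by move=> x Gx y /cyl_eq yx; rewrite /G /= yx.
have satW n : saturated n (seqDU G n).
  move=> x [Gx nGx] y xy; split; first exact: satG xy.
  rewrite -bigcup_mkord => -[i /= i_n Giy]; apply: nGx; rewrite -bigcup_mkord.
  exists i => //=; apply: (satG _ _ Giy); apply: cyl_le (ltnW i_n) _ _.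
  exact: cyl_sym.
have mW n : measurable (seqDU G n) by exact: saturated_measurable (satW n).
have tW := @trivIset_seqDU _ G.
have mUW : measurable (\bigcup_n seqDU G n) by exact: bigcupT_measurable.
have mU := measurable_open oU; have mV := measurable_open oV.
apply: (@le_trans _ _ (mu1 (\bigcup_n seqDU G n))).
  apply: le_measure; rewrite ?inE// -seqDU_bigcup_eq => x Ax.
  have /openP/(_ _ (AU _ Ax))[N NU] := oU.
  have [n Nn mun] := AP x Ax N; exists n => //; split=> //.
  exact: subset_trans (cyl_le Nn) NU.
rewrite measure_semi_bigcup//.
apply: (@le_trans _ _ (\sum_(0 <= n <oo) a%:E * mu2 (seqDU G n))%E).
  apply: lee_nneseries => // n _; apply: saturated_le (satW n) _.
  by move=> x [[]].
rewrite nneseriesZl// -measure_semi_bigcup//.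
apply: (@le_trans _ _ (a%:E * mu2 U)%E).
  apply: lee_wpmul2l; first by rewrite lee_fin.
  apply: le_measure; rewrite ?inE// -seqDU_bigcup_eq => x [n _ [+ _]].
  by apply; exact: cyl_id.
have muU : (mu2 U <= mu2 A + (e / (a + 1))%:E)%E.
  apply: (@le_trans _ _ (mu2 (A `|` (U `&` V)))).
    apply: le_measure; rewrite ?inE//; first by apply: measurableU => //; exact: measurableI.
    move=> x Ux; have [|/AV] := pselect (A x); first by left.
    by right.
  apply: le_trans (measureU2 _ mA (measurableI _ _ mU mV)) _.
  by apply: leeD => //; exact: ltW.
apply: (@le_trans _ _ (a%:E * (mu2 A + (e / (a + 1))%:E))%E).
  by apply: lee_wpmul2l; rewrite ?lee_fin.
rewrite ge0_muleDr//; last by rewrite lee_fin ltW.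
apply: leeD => //; rewrite -EFinM lee_fin mulrCA ger_pMr// ler_pdivrMr ?mul1r.
  by rewrite lerDl.
by rewrite ltr_wpDl.
Qed.

End Covering.

Lemma pushforward_measure (R : realType) d d' (T : measurableType d)
    (T' : measurableType d') (mu : {measure set T -> \bar R}) (f : T -> T') :
  measurable_fun setT f ->
  exists nu : {measure set T' -> \bar R}, forall A, nu A = mu (f @^-1` A).
Proof. by move=> mf; unshelve eexists (pushforward mu f). Qed.

Lemma measurable_cyl_map (B B' : bratteli) (f : X B -> X B') :
  (forall x n, exists n', forall y, cyl n' x y -> cyl n (f x) (f y)) ->
  measurable_fun setT f.
Proof.
move=> fP; apply: (measurability (@borel B')) => [|_ [U oU <-]]; first by [].

rewrite setTI; apply: measurable_open; apply/openP => x Ux.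
have /openP/(_ _ Ux)[n nU] := oU; have [n' n'P] := fP x n.
by exists n' => y /n'P/nU.
Qed.

Lemma measure_partition (R : realType) (B : bratteli) (T : finType)
    (mu : {measure set (X B) -> \bar R}) (S : set (X B)) (f : X B -> T) :
  (forall t, measurable (S `&` [set x | f x = t])) ->
  mu S = (\sum_t mu (S `&` [set x | f x = t]))%E.
Proof.
move=> mS; have SE : S = \bigcup_t (S `&` [set x | f x = t]).
  by apply/seteqP; split=> [x Sx|x [t _ []]//]; exists (f x).
rewrite {1}SE measure_fin_bigcup//.
- rewrite (fsbigE (index_enum T))//; first by apply: eq_bigl => t; apply: mem_set.
  - exact: index_enum_uniq.
  - by move=> t _; rewrite mem_index_enum.
- exact: finite_finset.
- apply/trivIsetP => t u _ _ tu; apply/seteqP; split=> // x.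
  by case=> -[_ xt] [_ xu]; rewrite -xt -xu eqxx in tu.
Qed.

Section Markov.
Context {R : realType} {B : bratteli}.
Implicit Types (m : probability (X B) R) (x y : X B) (H : set (X B)).

Lemma mrestr_lty m H (mH : measurable H) : (mrestr m mH setT < +oo)%E.
Proof. by rewrite /mrestr setTI (le_lt_trans (probability_le1 m mH))// ltry. Qed.

Definition weight (P0 : vertex B -> R) (P : nat -> vertex B -> E B -> R) n x :=
  P0 (src (edges x 0)) * \prod_(i < n) P i (src (edges x i)) (edges x i).

Lemma markov_cyl m P0 P n x :
  is_markov m P0 P -> m (cyl n x) = (weight P0 P n x)%:E.
Proof.
move=> [_ _ mP]; have [xp _] := cyl_fin_path n x.
rewrite /cyl mP// top_edgeE; congr (_ * _)%:E.
by apply: eq_bigr => i _; rewrite tnth_mktuple.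
Qed.

Lemma markov_transition_gt0 m P0 P n e :
  is_markov m P0 P -> 0 < P n (src e) e.
Proof. by move=> [_ /(_ n)[_ /(_ (src e) e)[_ Pe] _] _]; exact: Pe. Qed.

Lemma weight_gt0 m P0 P n x : is_markov m P0 P -> 0 < weight P0 P n x.
Proof.
move=> mP; have [[P00 _] _ _] := mP; rewrite mulr_gt0//.
by apply: prodr_gt0 => i _; exact: markov_transition_gt0 mP.
Qed.

Lemma weight_cyl P0 P n x y : cyl n x y -> weight P0 P n y = weight P0 P n x.
Proof.
rewrite cylE !top_edgeE => -[xy0 xy]; rewrite /weight xy0; congr (_ * _).
by apply: eq_bigr => i _; rewrite xy.
Qed.

Lemma weightS P0 P n x :
  weight P0 P n.+1 x = weight P0 P n x * P n (src (edges x n)) (edges x n).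
Proof. by rewrite /weight big_ord_recr/= mulrA. Qed.

Lemma weight_tail P0 P N n x y : (N <= n)%N ->
  (forall i, (N <= i)%N -> edges x i = edges y i) ->
  weight P0 P n x * weight P0 P N y = weight P0 P n y * weight P0 P N x.
Proof.
move=> Nn xy; rewrite -(subnK Nn) addnC.
elim: (n - N)%N => [|k IHk]; first by rewrite addn0 mulrC.
by rewrite addnS !weightS mulrAC IHk mulrAC xy// leq_addr.
Qed.

Lemma weight_addn m P0 P (d : R) n k x : is_markov m P0 P -> 0 <= d ->
  (forall n e, d <= P n (src e) e) ->
  d ^+ k * weight P0 P n x <= weight P0 P (n + k) x.
Proof.
move=> mP d0 dP; elim: k => [|k IHk]; first by rewrite addn0 mul1r.
rewrite addnS weightS exprSr mulrAC.
apply: ler_pM => //; rewrite mulr_ge0// ?exprn_ge0//.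
exact/ltW/(weight_gt0 _ _ mP).
Qed.

(* Exchanging the prefixes of length [N] of [x] and [y] maps [cyl N x] onto [cyl N y]
   and, on cylinders, multiplies the measure by the constant ratio of the weights *)
Lemma swap_prefix_le m P0 P N x y H : is_markov m P0 P ->
  (forall i, (N <= i)%N -> edges x i = edges y i) -> measurable H ->
  (forall u v, (forall i, (N <= i)%N -> edges u i = edges v i) -> H u -> H v) ->
  (m (cyl N x `&` H) <=
   (weight P0 P N x / weight P0 P N y)%:E * m (cyl N y `&` H))%E.
Proof.
move=> mP xy mH tH.
have /choice[theta thetaP] z : exists z', (cyl N x z -> cyl N y z' /\
    forall i, (N <= i)%N -> edges z' i = edges z i) /\ (~ cyl N x z -> z' = z).
  have [xz|nxz] := pselect (cyl N x z); last by exists z.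
  have [|z' yz' z'z] := @cyl_splice _ N y z; last by exists z'.
  by rewrite (cyl_src xz) xy.
have mtheta : measurable_fun setT theta.
  apply: measurable_cyl_map => z n; exists (maxn n N) => u zu.
  have zuN : cyl N z u by apply: cyl_le zu; rewrite leq_maxr.
  have zun : cyl n z u by apply: cyl_le zu; rewrite leq_maxl.
  have [xz|nxz] := pselect (cyl N x z); last first.
    rewrite (thetaP z).2// (thetaP u).2// => xu; apply: nxz.
    exact: cyl_trans xu (cyl_sym zuN).
  have [yz tz] := (thetaP z).1 xz.
  have [yu tu] := (thetaP u).1 (cyl_trans xz zuN).
  have /cylE[t0 tN] := cyl_trans (cyl_sym yz) yu.
  apply/cylE; split=> // i i_n; case: (ltnP i N) => [/tN//|Ni].
  by rewrite tz// tu//; have /cylE[_ ->] := zun.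
have mCx := measurable_cyl N x; have mCy := measurable_cyl N y.
pose mx := mrestr m mCx; pose my := mrestr m mCy.
have [mu1 mu1E] := pushforward_measure mx mtheta.
have wx := weight_gt0 N x mP; have wy := weight_gt0 N y mP.
have : (mu1 H <= (weight P0 P N x / weight P0 P N y)%:E * my H)%E.
  apply: covering_le => //.
  - exact: mrestr_lty.
  - by rewrite divr_ge0// ltW.
  move=> z _ N'; exists (maxn N N'); rewrite ?leq_maxr//.
  set n := maxn N N'; have Nn : (N <= n)%N by rewrite leq_maxl.
  rewrite mu1E /mx /my /= /mrestr.
  have [[u [/= zu xu]]|no] := pselect ((theta @^-1` cyl n z `&` cyl N x) !=set0); last first.
    have -> : theta @^-1` cyl n z `&` cyl N x = set0.
      by apply/eqP; apply/negPn; apply/negP => /set0P.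
    by rewrite measure0 mule_ge0// lee_fin divr_ge0// ltW.
  have [yu tu] := (thetaP u).1 xu.
  have -> : cyl n z `&` cyl N y = cyl n z.
    apply/setIidPl => v zv; apply: cyl_trans yu _.
    by apply: cyl_le Nn _ _; apply: cyl_trans zv; exact: cyl_sym.
  apply: (@le_trans _ _ (m (cyl n u))).
    apply: le_measure; rewrite ?inE.
    - apply: measurableI => //; rewrite -[X in measurable X]setTI; apply: mtheta => //.
      exact: measurable_cyl.
    - exact: measurable_cyl.
    move=> v [/= zv xv]; have [yv tv] := (thetaP v).1 xv.
    have /cylE[u0 uN] := cyl_trans (cyl_sym xu) xv.
    apply/cylE; split=> // i i_n; case: (ltnP i N) => [/uN//|Ni].
    rewrite -tv// -tu//.
    by have /cylE[_ ->] := cyl_trans (cyl_sym zu) zv.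
  rewrite !(markov_cyl _ _ mP) -EFinM lee_fin -(weight_cyl P0 P zu) mulrAC.
  rewrite ler_pdivlMr// [leRHS]mulrC -(weight_cyl P0 P yu) -(weight_cyl P0 P xu).
  by rewrite (weight_tail P0 P Nn (fun i Ni => esym (tu i Ni))).
congr (_ <= _)%E; last by rewrite /my /mrestr setIC.
rewrite mu1E /mx /mrestr; congr (m _).
apply/seteqP; split=> z [].
  by move=> zH xz; split=> //; have [_ tz] := (thetaP z).1 xz; exact: tH zH.
move=> xz zH; split=> //; have [_ tz] := (thetaP z).1 xz.
by apply: tH zH => i Ni; rewrite tz.
Qed.

Definition tail_set H := forall N x y,
  (forall i, (N <= i)%N -> edges x i = edges y i) -> H x -> H y.

Definition bounded_markov m P0 P := is_markov m P0 P /\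
  exists2 d : R, 0 < d & forall n e, d <= P n (src e) e.

(* A density point of [~` H] gives a cylinder in which [H] has small conditional
   measure; [k] further edges lead to any vertex with conditional probability at
   least [d ^+ k], and exchanging prefixes spreads the estimate to all cylinders *)
Lemma zero_one_law m P0 P H : bounded_markov m P0 P -> measurable H ->
  tail_set H -> (0 < m H)%E -> m (~` H) = 0.
Proof.
move=> [mP [d d0 dP]] mH tH Hgt0.
have [|cH] := eqVneq (m (~` H)) 0 => //.
suff : (m H <= 0)%E by rewrite leNgt Hgt0.
apply/lee_addgt0Pr => e e0; rewrite add0e.
have [k _ walk] := @walkP B.
have edk : 0 < e * d ^+ k by rewrite mulr_gt0// exprn_gt0.
pose mH' := mrestr m mH.
have [x [N NP]] : exists x N, (m (cyl N x `&` H) <= (e * d ^+ k)%:E * m (cyl N x))%E.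
  apply: contrapT => no; move/negP: cH; apply.
  rewrite eq_le measure_ge0 andbT.
  have : (m (~` H) <= ((e * d ^+ k)^-1)%:E * mH' (~` H))%E.
    apply: covering_le.
    - exact: mrestr_lty.
    - exact: measurableC.
    - by rewrite invr_ge0 ltW.
    move=> x _ N; exists N => //; rewrite leNgt; apply/negP => mlt.
    apply: no; exists x, N; move: mlt; rewrite /mH' /= /mrestr.
    have mCH : measurable (cyl N x `&` H) by apply: measurableI => //; exact: measurable_cyl.
    rewrite (markov_cyl _ _ mP) -(fineK (fin_num_measure m _ mCH)) -!EFinM lte_fin lee_fin.
    by rewrite mulrC ltr_pdivrMr// mulrC => /ltW.
  by rewrite /mH' /mrestr setICl measure0 mule0.
have : (mH' setT <= e%:E * m setT)%E; last first.
  by rewrite /mH' /mrestr setTI probability_setT mule1.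
apply: (@saturated_le _ _ _ _ (N + k)); first by [].
move=> y _; rewrite /mH' /= /mrestr.
have [z xz zy] := cyl_walk N x y walk.
have wz := weight_gt0 (N + k) z mP; have wy := weight_gt0 (N + k) y mP.
apply: le_trans (swap_prefix_le mP (fun i Ni => esym (zy i Ni)) mH (tH (N + k)%N)) _.
have mzH : measurable (cyl (N + k) z `&` H) by apply: measurableI => //; exact: measurable_cyl.
have : (m (cyl (N + k) z `&` H) <= (e * d ^+ k)%:E * m (cyl N z))%E.
  rewrite (cyl_eq xz); apply: le_trans NP; apply: le_measure; rewrite ?inE//.
    by apply: measurableI => //; exact: measurable_cyl.
  apply: setSI; rewrite -(cyl_eq xz); apply: cyl_le; exact: leq_addr.
rewrite !(markov_cyl _ _ mP) -(fineK (fin_num_measure m _ mzH)) -!EFinM !lee_fin.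
move=> le1; rewrite mulrAC ler_pdivrMr// mulrC [leRHS]mulrAC ler_pM2r//.
apply: le_trans le1 _; rewrite -mulrA ler_pM2l//.
exact: (weight_addn _ _ _ mP) (ltW d0) dP.
Qed.

End Markov.

Lemma finite_pos_lb (R : realType) (T : finType) (f : T -> R) :
  (forall t, 0 < f t) -> exists2 d, 0 < d & forall t, d <= f t.
Proof.
move=> f0; exists (\big[Num.min/1]_t f t); last by move=> t; exact: bigmin_le.
by apply: lt_bigmin.
Qed.

Lemma cvg_pos_lb (R : realType) (u : nat -> R) (l : R) :
  (forall n, 0 < u n) -> 0 < l -> u @ \oo --> l ->
  exists2 d, 0 < d & forall n, d <= u n.
Proof.
move=> u0 l0 ul.
have [N _ NP] : \forall n \near \oo, l / 2 < u n.
  by apply: (cvgr_gt _ ul); rewrite gtr_pMr// invf_lt1// ltr1n.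
have [d d0 dP] := finite_pos_lb (fun i : 'I_N => u0 i).
exists (Num.min d (l / 2)); first by rewrite lt_min d0 divr_gt0.
move=> n; rewrite ge_min; case: (ltnP n N) => nN.
  by rewrite (dP (Ordinal nN)).
by rewrite (ltW (NP n nN)) orbT.
Qed.

Section Cycle.
Context {B : bratteli}.

Lemma fin_path_nth v (s : seq (E B)) d i : fin_path v s -> (i < size s)%N ->
  src (nth d s i) = nth v (v :: [seq rng f | f <- s]) i.
Proof.
elim: s v i => [//|e s IHs] v [|i] /= /andP[/eqP ev es]; first by [].
rewrite ltnS => i_s; rewrite (IHs _ _ es i_s).
by apply: set_nth_default; rewrite /= size_map ltnW.
Qed.

Lemma edge_on_cycle (e : E B) : exists k (c : 'I_k.+1 -> E B),
  c ord0 = e /\ forall i, rng (c i) = src (c (i + inZp 1)).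
Proof.
have [k _ walk] := @walkP B; have [s [sk sp se]] := walk (rng e) (src e).
exists k, (fun i => nth e (e :: s) i); split=> // i.
have -> : nat_of_ord (i + inZp 1) = (i.+1 %% k.+1)%N by rewrite /= modnDmr addn1.
have -> : rng (nth e (e :: s) i) = nth (rng e) (rng e :: [seq rng f | f <- s]) i.
  by rewrite -map_cons (nth_map e)//= sk.
have := ltn_ord i; rewrite ltnS leq_eqVlt => /orP[/eqP ik|ik].
  rewrite ik modnn /= -se /end_vertex (last_nth (rng e)).
  by rewrite size_map sk.
by rewrite modn_small//= -(fin_path_nth e sp)// sk.
Qed.

Lemma rotated_cycle k (c : 'I_k.+1 -> E B) (a : 'I_k.+1) :
  (forall i, rng (c i) = src (c (i + inZp 1))) ->
  exists x : X B, forall n, edges x n = c (inZp n + a).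
Proof.
move=> cP.
have xP : is_path (src (c (inZp 0 + a)), fun n => c (inZp n + a)).
  split=> // n /=; rewrite cP addrAC; congr (src (c (_ + a))).
  by apply: val_inj; rewrite /= modnDml modnDmr addn1.
by exists (exist _ _ xP).
Qed.

End Cycle.

Section Extension.
Context {B : bratteli}.

Lemma measurable_edge n (e : E B) : measurable [set y : X B | edges y n = e].
Proof.
apply: (@saturated_measurable _ n.+1) => x /= <- y.
by rewrite cylSI => -[].
Qed.

Lemma cyl_extend n (x : X B) (e : E B) : src e = src (edges x n) ->
  exists2 y, cyl n x y & edges y n = e.
Proof.
move=> ex; have [z ze] := path_from (rng e); pose z' := sigma (ze : D e z).
have [xp xn] := cyl_fin_path n x.
have [|y [y0 yx yz]] := @prepend_word _ _ _ z' xp; first by rewrite xn -ex.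
rewrite size_tuple in yx yz; exists y; last by rewrite -[n]addn0 yz.
rewrite cylE !top_edgeE y0 top_edgeE; split=> // i i_n.
by rewrite (yx e)// -[i]/(val (Ordinal i_n)) -tnth_nth tnth_mktuple.
Qed.

End Extension.

Section Kinds.
Context {R : realType} {B : bratteli}.
Implicit Types (m : probability (X B) R) (x y : X B).

Lemma stationary_bounded m P0 p :
  is_stationary_markov m P0 p -> bounded_markov m P0 (fun=> p).
Proof.
move=> mp; split=> //.
have [d d0 dP] := finite_pos_lb (fun e => markov_transition_gt0 0 e mp).
by exists d.
Qed.

Lemma transition_le1 m P0 P n e : is_markov m P0 P -> P n (src e) e <= 1.
Proof.
move=> [_ /(_ n)[P_ge0 _ /(_ (src e)) <-] _].
by rewrite (bigD1 e)//= lerDl sumr_ge0.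
Qed.

(* Along the rotations of a cycle [c] through [e], the product of all the partial
   products telescopes to [\prod_a P n (c a) / P 0 (c a)]; hence this quantity,
   and each of its factors [P n (c a) <= 1], stays away from [0] *)
Lemma quasi_stationary_bounded m P0 P :
  is_quasi_stationary_markov m P0 P -> bounded_markov m P0 P.
Proof.
move=> [mP qP]; split=> //.
have Pgt0 n e : 0 < P n (src e) e := markov_transition_gt0 n e mP.
suff /choice[f fP] : forall e : E B, exists d : R,
    0 < d /\ forall n, d <= P n (src e) e.
  have [d d0 dP] := finite_pos_lb (fun e => (fP e).1).
  by exists d => // n e; apply: le_trans (dP e) _; exact: (fP e).2.
move=> e; have [k [c [c0 cP]]] := edge_on_cycle e; subst e.
pose r i (e : E B) := P i.+1 (src e) e / P i (src e) e.
have r0 i e : 0 < r i e by rewrite divr_gt0.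
have /choice[d dP] : forall a : 'I_k.+1, exists d : R, 0 < d /\
    forall n, d <= \prod_(i < n) r i (c (inZp i + a)).
  move=> a; have [x xa] := rotated_cycle a cP; have [l l0 ul] := qP x.
  have ugt0 n : 0 < \prod_(i < n) r i (edges x i).
    by apply: prodr_gt0 => i _.
  have [d d0 dn] := cvg_pos_lb ugt0 l0 ul; exists d; split=> // n.
  by apply: le_trans (dn n) _; rewrite le_eqVlt; apply/orP; left; apply/eqP;
    apply: eq_bigr => i _; rewrite xa.
have teles n : \prod_a \prod_(i < n) r i (c (inZp i + a)) =
    \prod_a (P n (src (c a)) (c a) / P 0%N (src (c a)) (c a)).
  rewrite exchange_big /=.
  rewrite (eq_bigr (fun i : 'I_n => \prod_a r i (c a))); last first.
    by move=> i _; rewrite [RHS](reindex_inj (addrI (inZp i))).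
  rewrite exchange_big /=; apply: eq_bigr => a _.
  elim: n => [|n IHn]; first by rewrite big_ord0 divff// gt_eqF.
  by rewrite big_ord_recr /= IHn /r [LHS]mulrC mulrA divfK// gt_eqF.
exists (\prod_a (d a * P 0%N (src (c a)) (c a))); split.
  by apply: prodr_gt0 => a _; rewrite mulr_gt0//; case: (dP a).
move=> n; apply: (@le_trans _ _ (\prod_a P n (src (c a)) (c a))).
  have -> : \prod_a P n (src (c a)) (c a) =
      (\prod_a \prod_(i < n) r i (c (inZp i + a))) *
      \prod_a P 0%N (src (c a)) (c a).
    by rewrite teles -big_split; apply: eq_bigr => a _ /=; rewrite divfK// gt_eqF.
  rewrite big_split /= ler_pM2r; last by apply: prodr_gt0 => a _.
  by apply: ler_prod => a _; have [da dn] := dP a; rewrite ltW//= dn.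
rewrite (bigD1 ord0)//= ger_pMr//.
by apply: prodr_ile1 => a _; apply/andP; split; [exact/ltW/Pgt0|exact: transition_le1 mP].
Qed.

(* [M n v] is the common measure of the cylinders of length [n] ending at [v]; letting
   the transition probabilities depend on [n] avoids the Perron-Frobenius theorem *)
Lemma tail_invariant_bounded m : tail_invariant m ->
  exists P0 P, bounded_markov m P0 P.
Proof.
move=> tm.
have /choice[pt ptP] : forall p : nat * vertex B,
    exists x : X B, src (edges x p.1) = p.2.
    by case=> n v; exact: path_through.
pose M n v := fine (m (cyl n (pt (n, v)))).
have finm A : measurable A -> m A \is a fin_num by exact: fin_num_measure.
have mM n x : m (cyl n x) = (M n (src (edges x n)))%:E.
  rewrite /M fineK; last by apply: finm; exact: measurable_cyl.
  have [p e] := cyl_fin_path n x.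
  have [p' e'] := cyl_fin_path n (pt (n, src (edges x n))).
  by apply: tm => //; rewrite e e' ptP.
have M_ge0 n v : 0 <= M n v by rewrite /M fine_ge0.
have Msum n v : M n v = \sum_(e : E B | src e == v) M n.+1 (rng e).
  set x := pt (n, v); have xn : src (edges x n) = v := ptP (n, v).
  apply: EFin_inj; rewrite -xn -mM.
  rewrite (measure_partition m (f := fun y => edges y n)); last first.
    by move=> e; apply: measurableI; [exact: measurable_cyl|exact: measurable_edge].
  rewrite -sumEFin [RHS]big_mkcond /=; apply: eq_bigr => e _.
  case: eqP => [exn|exn]; last first.
    suff -> : cyl n x `&` [set y | edges y n = e] = set0 by rewrite measure0.
    by apply/seteqP; split=> // y [/cyl_src xy ye]; apply: exn; rewrite -ye.
  have [u xu ue] := cyl_extend exn.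
  have -> : cyl n x `&` [set y | edges y n = e] = cyl n.+1 u.
    rewrite -(cyl_eq xu); apply/seteqP; split=> y; rewrite cylSI ue; first by case.
    by case.
  by rewrite mM -edges_step ue.
have [k _ walk] := @walkP B.
have M_walk n j v w : (forall v w, exists s : seq (E B),
    [/\ size s = j, fin_path v s & end_vertex v s = w]) -> M (n + j)%N w <= M n v.
  move=> walkj.
  have [z xz zy] := cyl_walk n (pt (n, v)) (pt ((n + j)%N, w)) walkj.
  have : (m (cyl (n + j) z) <= m (cyl n z))%E.
    by apply: le_measure; rewrite ?inE; [exact: measurable_cyl..|exact/cyl_le/leq_addr].
  by rewrite !mM lee_fin (cyl_src xz) (ptP (n, v)) zy// (ptP (_, w)).
have M_gt0 n v : 0 < M n v.
  rewrite lt_neqAle M_ge0 andbT eq_sym; apply/eqP => M0.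
  have : (m setT <= 0%:E * m setT)%E.
    apply: (@saturated_le _ _ _ _ (n + k)) => // y _.
    by rewrite mul0e /= mM lee_fin -M0; exact: M_walk.
  by rewrite mul0e probability_setT lee_fin ler10.
have M_ub n j (c : R) : (forall u, M (n + j)%N u <= c) ->
    forall v, M n v <= #|{: E B}|%:R ^+ j * c.
  elim: j c => [|j IHj] c; first by rewrite addn0 mul1r.
  move=> cP v; rewrite exprSr -mulrA; apply: IHj => u; rewrite Msum.
  apply: (@le_trans _ _ (\sum_(e : E B) c)); last by rewrite sumr_const mulr_natl.
  rewrite big_mkcond /=; apply: ler_sum => e _; case: ifP => _; first by rewrite -addnS.
  by apply: le_trans (M_ge0 (n + j.+1)%N u) _; exact: cP.
pose P0 v := M 0%N v.
pose P n v (e : E B) := if src e == v then M n.+1 (rng e) / M n v else 0.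
have Psrc n e : P n (src e) e = M n.+1 (rng e) / M n (src e) by rewrite /P eqxx.
exists P0, P; split; last first.
  have E0 : (0 : R) < #|{: E B}|%:R ^+ k.+1.
    rewrite exprn_gt0// ltr0n; apply/card_gt0P.
    by exists (edges (X_point B) 0).
  exists ((#|{: E B}|%:R ^+ k.+1)^-1); first by rewrite invr_gt0.
  move=> n e; rewrite Psrc ler_pdivlMr// mulrC ler_pdivrMr// mulrC.
  apply: M_ub => u; rewrite addnS -addSn; exact: M_walk.
split.
- split=> [v|]; first exact: M_gt0.
  apply: EFin_inj; rewrite -(@probability_setT _ _ _ m) -sumEFin.
  have topE v : [set: X B] `&` [set x | top_edge x = v] = cyl 0 (pt (0%N, v)).
    rewrite setTI; apply/seteqP; split=> x; rewrite cylE [top_edge (pt _)]top_edgeE ptP.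
      by [].
    by case.
  rewrite (measure_partition m (f := @top_edge _ _)).
    by apply: eq_bigr => v _; rewrite topE /= mM ptP.
  by move=> v; rewrite topE; exact: measurable_cyl.
- move=> n; split.
  + by move=> v e; rewrite /P; case: ifP => // _; rewrite divr_ge0.
  + by move=> v e; rewrite /P; case: eqP => [ev|ev]; split=> //; rewrite ?ltxx// divr_gt0.
  + move=> v; rewrite (eq_bigr (fun e => M n.+1 (rng e) / M n v)); last first.
      by move=> e ev; rewrite /P ev.
    by rewrite -mulr_suml -Msum divff// gt_eqF.
- move=> n v w /fin_path_cyl[x [wx xn xv]].
  have [/= _ xw] : cylinder v w x by rewrite wx; exact: cyl_id.
  rewrite wx mM; congr EFin.
  under eq_bigr do rewrite -xw Psrc edges_step.
  rewrite -xv /P0; elim: n {w wx xn xw} => [|n IHn]; first by rewrite big_ord0 mulr1.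
  by rewrite big_ord_recr /= mulrA -IHn mulrC divfK// gt_eqF.
Qed.

Lemma claim_bounded m : measure_in_claim m -> exists P0 P, bounded_markov m P0 P.
Proof.
case=> [/tail_invariant_bounded//|[P0 [p /stationary_bounded]]|[P0 [P]]].
  by exists P0, (fun=> p).
by move=> /quasi_stationary_bounded; exists P0, P.
Qed.

End Kinds.

Section Sequences.
Context {R : realType}.

Definition infinitely_often (Q : nat -> Prop) :=
  forall N, exists2 n, (N <= n)%N & Q n.

Lemma not_infinitely_often (Q : nat -> Prop) :
  ~ infinitely_often Q -> exists N, forall n, (N <= n)%N -> ~ Q n.
Proof.
move=> ioQ; apply: contrapT => no; apply: ioQ => N; apply: contrapT => no'.
by apply: no; exists N => n Nn Qn; apply: no'; exists n.
Qed.

Lemma cvg_no_oscillation (z : nat -> R) (a b : R) : 0 < a ->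
  ~ infinitely_often (fun n => z n <= a) ->
  ~ infinitely_often (fun n => b <= z n) ->
  (forall p q : rat, 0 < p -> p < q ->
    infinitely_often (fun n => z n <= ratr p) ->
    ~ infinitely_often (fun n => ratr q <= z n)) ->
  exists2 l : R, 0 < l & z @ \oo --> l.
Proof.
move=> a0 /not_infinitely_often[Na aP] /not_infinitely_often[Nb bP] noosc.
pose S := [set c | exists N, forall n, (N <= n)%N -> c <= z n].
have Sa : S a by exists Na => n /aP/negP; rewrite -ltNge => /ltW.
have Sb : ubound S b.
  move=> c [N cP]; have := cP (maxn N Nb) (leq_maxl _ _).
  have /negP := bP (maxn N Nb) (leq_maxr _ _).
  by rewrite -ltNge => zb cz; exact: ltW (le_lt_trans cz zb).
have supS : has_sup S by split; [exists a|exists b].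
have al : a <= sup S by exact: (ub_le_sup supS.2) _ Sa.
exists (sup S); first exact: lt_le_trans al.
apply/cvgrPdist_lt => e e0.
have [c [Nc cP] ce] := sup_adherent e0 supS.
have lle : sup S < sup S + e by rewrite ltrDl.
have [q] := rat_in_itvoo lle; rewrite in_itv /= => /andP[lq qe].
have [p] := rat_in_itvoo lq; rewrite in_itv /= => /andP[lp pq].
have pio : infinitely_often (fun n => z n <= ratr p).
  move=> N; apply: contrapT => no; move: lp; apply/negP; rewrite -leNgt.
  apply: (ub_le_sup supS.2); exists N => n Nn; rewrite leNgt; apply/negP => znp.
  by apply: no; exists n => //; exact: ltW.
have p0 : 0 < p by rewrite -(ltr0q R); apply: lt_trans lp; exact: lt_le_trans al.
rewrite ltr_rat in pq.
have [Nq qP] := not_infinitely_often (noosc p q p0 pq pio).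
exists (maxn Nc Nq) => // n /=; rewrite geq_max => /andP[cn qn].
have /negP := qP n qn; rewrite -ltNge => zq.
have cz := cP n cn.
rewrite ltr_distlC; apply/andP; split.
  exact: lt_le_trans ce cz.
exact: lt_trans zq qe.
Qed.

End Sequences.

Section Comparison.
Context {R : realType} {B : bratteli}.
Implicit Types (mu : {measure set (X B) -> \bar R}) (A : set (X B)) (Q : nat -> set (X B)).

Lemma measurable_infinitely_often Q : (forall n, saturated n (Q n)) ->
  measurable [set x | infinitely_often (fun n => Q n x)].
Proof.
move=> satQ.
have -> : [set x | infinitely_often (fun n => Q n x)] =
    \bigcap_N \bigcup_(n in [set n | (N <= n)%N]) Q n.
  apply/seteqP; split=> x xQ N; first by move=> _; have [n Nn Qn] := xQ N; exists n.
  by have [n Nn Qn] := xQ N I; exists n.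
apply: bigcap_measurable => // N _; apply: bigcup_measurable => n _.
exact: saturated_measurable (satQ n).
Qed.

Lemma le0_of_le_small (x y : \bar R) : (0 <= y)%E -> (y < +oo)%E ->
  (forall c : R, 0 < c -> (x <= c%:E * y)%E) -> (x <= 0)%E.
Proof.
move=> y0 yoo xy; apply/lee_addgt0Pr => e e0; rewrite add0e.
have yfin : y \is a fin_num by rewrite ge0_fin_numE.
have f0 : 0 <= fine y by exact: fine_ge0.
have d0 : 0 < fine y + 1 by rewrite ltr_wpDl.
apply: le_trans (xy (e / (fine y + 1)) _) _; first by rewrite divr_gt0.
rewrite -(fineK yfin) -EFinM lee_fin mulrAC ler_pdivrMr// ler_pM2l// lerDl.
exact: ler01.
Qed.

Lemma le_measureT mu A : measurable A -> (mu A <= mu setT)%E.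
Proof. by move=> mA; apply: le_measure; rewrite ?inE. Qed.

Variables (mu nu : {measure set (X B) -> \bar R}) (u w : nat -> X B -> R).
Hypotheses (muT : (mu setT < +oo)%E) (nuT : (nu setT < +oo)%E).
Hypotheses (u_gt0 : forall n x, 0 < u n x) (w_gt0 : forall n x, 0 < w n x).
Hypotheses (mu_cyl : forall n x, mu (cyl n x) = (u n x)%:E)
           (nu_cyl : forall n x, nu (cyl n x) = (w n x)%:E).

Lemma density_cyl n x y : cyl n x y -> u n y = u n x /\ w n y = w n x.
Proof.
by move=> /cyl_eq xy; split; apply: EFin_inj; rewrite -?mu_cyl -?nu_cyl xy.
Qed.

Lemma unbounded_density_null :
  let A := [set x | forall j : nat,
    infinitely_often (fun n => j.+1%:R * u n x <= w n x)] in
  measurable A /\ mu A = 0%E.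
Proof.
move=> A.
have mA : measurable A.
  have -> : A = \bigcap_j [set x | infinitely_often
      (fun n => [set x | j.+1%:R * u n x <= w n x] x)].
    by apply/seteqP; split=> x xA j; [move=> _; exact: xA|exact: xA j I].
  apply: bigcap_measurable => // j _; apply: measurable_infinitely_often => n x.
  by move=> ux y /density_cyl[/= -> ->].
split=> //; apply/eqP; rewrite eq_le measure_ge0 andbT.
apply: (le0_of_le_small (measure_ge0 nu A)).
  exact: le_lt_trans (le_measureT nu mA) nuT.
move=> c c0; apply: covering_le => //; first exact: ltW.
move=> x /(_ (Num.truncn c^-1)) xA N; have [n Nn un] := xA N; exists n => //.
rewrite mu_cyl nu_cyl -EFinM lee_fin -ler_pdivrMl//.
apply: le_trans un; rewrite ler_pM2r//; exact/ltW/truncnS_gt.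
Qed.

Lemma oscillating_density_null (p q : R) : 0 < p -> p < q ->
  let A := [set x | infinitely_often (fun n => w n x <= p * u n x)] `&`
           [set x | infinitely_often (fun n => q * u n x <= w n x)] in
  measurable A /\ mu A = 0%E.
Proof.
move=> p0 pq A.
have mA : measurable A.
  apply: measurableI.
    apply: (@measurable_infinitely_often (fun n => [set x | w n x <= p * u n x])).
    by move=> n x ux y /density_cyl[/= -> ->].
  apply: (@measurable_infinitely_often (fun n => [set x | q * u n x <= w n x])).
  by move=> n x ux y /density_cyl[/= -> ->].
split=> //.
have q0 : 0 < q := lt_trans p0 pq.
have muA : (mu A <= (q^-1)%:E * nu A)%E.
  apply: covering_le => //; first by rewrite invr_ge0 ltW.
  move=> x [_ xA] N; have [n Nn un] := xA N; exists n => //.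
  by rewrite mu_cyl nu_cyl -EFinM lee_fin -ler_pdivrMl ?invr_gt0// invrK.
have nuA : (nu A <= p%:E * mu A)%E.
  apply: covering_le => //; first exact: ltW.
  move=> x [xA _] N; have [n Nn un] := xA N; exists n => //.
  by rewrite mu_cyl nu_cyl -EFinM lee_fin.
have Afin : mu A \is a fin_num.
  by rewrite ge0_fin_numE// (le_lt_trans (le_measureT mu mA)).
have : (mu A <= (q^-1 * p)%:E * mu A)%E.
  apply: le_trans muA _; rewrite EFinM -muleA; apply: lee_wpmul2l => //.
  by rewrite lee_fin invr_ge0 ltW.
rewrite -(fineK Afin) -EFinM lee_fin => muA1; congr EFin.
apply/eqP; rewrite eq_le fine_ge0// andbT leNgt; apply/negP => f0.
move: muA1; rewrite leNgt gtr_pMl// mulrC ltr_pdivrMr// mul1r.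
by rewrite pq.
Qed.

Definition bounded_density := [set x | exists K : nat,
  forall n, (K <= n)%N -> w n x <= K%:R * u n x].

Let bounded_by K := [set x | forall n, (K <= n)%N -> w n x <= K%:R * u n x].

Let measurable_bounded_by K : measurable (bounded_by K).
Proof.
have -> : bounded_by K =
    \bigcap_(n in [set n | (K <= n)%N]) [set x | w n x <= K%:R * u n x].
  by apply/seteqP; split=> x xH n Kn; exact: xH.
apply: bigcap_measurable; first by exists K => /=.
move=> n _; apply: (@saturated_measurable _ n) => x ux y.
by move=> /density_cyl[/= -> ->].
Qed.

Let bounded_densityE : bounded_density = \bigcup_K bounded_by K.
Proof. by apply/seteqP; split=> x [K]; [exists K|move=> _; exists K]. Qed.

Lemma measurable_bounded_density : measurable bounded_density.
Proof. by rewrite bounded_densityE; exact: bigcupT_measurable. Qed.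

Lemma null_of_bounded_density A : measurable A ->
  nu (~` bounded_density) = 0%E -> mu A = 0%E -> nu A = 0%E.
Proof.
move=> mA nuH muA; have mH := measurable_bounded_density.
have nuAH K : nu (A `&` bounded_by K) = 0%E.
  apply/eqP; rewrite eq_le measure_ge0 andbT.
  have : (nu (A `&` bounded_by K) <= K%:R%:E * mu (A `&` bounded_by K))%E.
    apply: covering_le => //; first exact: measurableI.
    move=> x [_ xH] N; exists (maxn K N); rewrite ?leq_maxr// mu_cyl nu_cyl.
    by rewrite -EFinM lee_fin xH// leq_maxl.
  suff -> : mu (A `&` bounded_by K) = 0%E by rewrite mule0.
  apply/eqP; rewrite eq_le measure_ge0 andbT -muA.
  by apply: le_measure; rewrite ?inE//; exact: measurableI.
have mUAH : measurable (\bigcup_K (A `&` bounded_by K)).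
  by apply: bigcupT_measurable => K; exact: measurableI.
apply/negligibleP => //.
apply: (@negligibleS _ _ _ _ ((A `\` bounded_density) `|` \bigcup_K (A `&` bounded_by K))).
  move=> x Ax; have [[K xH]|nxH] := pselect (bounded_density x); last by left.
  by right; exists K.
apply: negligibleU; last first.
  apply: negligible_bigcup => K.
  by apply/negligibleP; [exact: measurableI|exact: nuAH].
apply: (@negligibleS _ _ _ _ (~` bounded_density)); first by move=> x [].
by apply/negligibleP => //; exact: measurableC.
Qed.

Lemma tail_set_bounded_density :
  (forall N n x y, (N <= n)%N -> (forall i, (N <= i)%N -> edges x i = edges y i) ->
    u n x * u N y = u n y * u N x) ->
  (forall N n x y, (N <= n)%N -> (forall i, (N <= i)%N -> edges x i = edges y i) ->
    w n x * w N y = w n y * w N x) ->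
  tail_set bounded_density.
Proof.
move=> u_tail w_tail N x y xy [K KP].
pose c := K%:R * (w N y / w N x) * (u N x / u N y).
have cP n : (maxn N K <= n)%N -> w n y <= c * u n y.
  rewrite geq_max => /andP[Nn Kn].
  have -> : w n y = w n x * (w N y / w N x).
    by rewrite mulrA (w_tail _ _ _ _ Nn xy) mulfK// gt_eqF.
  have -> : c * u n y = K%:R * u n x * (w N y / w N x).
    have -> : u n x = u n y * u N x / u N y.
      by rewrite -(u_tail _ _ _ _ Nn xy) mulfK// gt_eqF.
    by rewrite /c; ring.
  by rewrite ler_pM2r ?divr_gt0// KP.
exists (maxn (maxn N K) (Num.truncn c).+1) => n; rewrite geq_max => /andP[n1 n2].
apply: le_trans (cP n n1) _; rewrite ler_pM2r//.
apply: le_trans (ltW (truncnS_gt c)) _.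
by rewrite ler_nat leq_maxr.
Qed.

End Comparison.

Lemma density_cvg (R : realType) (B : bratteli)
    (mu nu : {measure set (X B) -> \bar R}) (u w : nat -> X B -> R) :
  (mu setT < +oo)%E -> (nu setT < +oo)%E ->
  (forall n x, 0 < u n x) -> (forall n x, 0 < w n x) ->
  (forall n x, mu (cyl n x) = (u n x)%:E) ->
  (forall n x, nu (cyl n x) = (w n x)%:E) ->
  (forall A, measurable A -> nu A = 0%E -> mu A = 0%E) ->
  {ae mu, forall x, exists2 l : R, 0 < l & (fun n => w n x / u n x) @ \oo --> l}.
Proof.
move=> muT nuT u0 w0 muc nuc numu.
have [mS muS] := unbounded_density_null nuT u0 muc nuc.
have [mI nuI] := unbounded_density_null muT w0 nuc muc.
set S := [set x | _] in mS muS; set I := [set x | _] in mI nuI.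
pose osc (p q : R) := [set x | infinitely_often (fun n => w n x <= p * u n x)] `&`
           [set x | infinitely_often (fun n => q * u n x <= w n x)].
pose F k := if (choice.unpickle k : option (rat * rat)) is Some (p, q) then
  if (0 < p) && (p < q) then osc (ratr p) (ratr q) else set0 else set0.
have negF k : mu.-negligible (F k).
  rewrite /F; case: (choice.unpickle k : option (rat * rat)) => [[p q]|]; last exact: negligible_set0.
  case: ifP => [/andP[p0 pq]|_]; last exact: negligible_set0.
  have p0' : 0 < ratr p :> R by rewrite ltr0q.
  have pq' : ratr p < ratr q :> R by rewrite ltr_rat.
  have [mO muO] := oscillating_density_null muT nuT muc nuc p0' pq'.
  by apply/negligibleP.
have negS : mu.-negligible (S `|` I).
  apply: negligibleU; apply/negligibleP => //; exact: numu.
apply: negligibleS (negligibleU negS (negligible_bigcup negF)).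
move=> x ncvg; apply: contrapT => nx; apply: ncvg.
have nxS : ~ S x by move=> Sx; apply: nx; left; left.
have nxI : ~ I x by move=> Ix; apply: nx; left; right.
have /existsNP[jS njS] := nxS; have /existsNP[jI njI] := nxI.
apply: (@cvg_no_oscillation _ _ (jI.+1%:R^-1) (jS.+1%:R)); first by rewrite invr_gt0.
- move=> io; apply: njI => N; have [n Nn zn] := io N; exists n => //.
  by move: zn; rewrite ler_pdivrMr// ler_pdivlMl.
- move=> io; apply: njS => N; have [n Nn zn] := io N; exists n => //.
  by move: zn; rewrite ler_pdivlMr.
move=> p q p0 pq iop ioq; apply: nx; right.
exists (choice.pickle (p, q)); first by [].
have -> : F (choice.pickle (p, q)) = osc (ratr p) (ratr q).
  by rewrite /F choice.pickleK p0 pq.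
split=> N.
  by have [n Nn zn] := iop N; exists n => //; move: zn; rewrite ler_pdivrMr.
by have [n Nn zn] := ioq N; exists n => //; move: zn; rewrite ler_pdivlMr.
Qed.

Section Transport.
Context {B B' : bratteli} {alpha : E B -> E B'} (adm : admissible alpha).
Let f := induced_map adm.

Lemma admissible_src e e' : src e = src e' <-> src (alpha e) = src (alpha e').
Proof.
have [[beta alphaK betaK] admE] := adm; split=> ee'.
  have [g ge] := rng_surj (src e).
  by rewrite -(admE g e).1// (admE g e').1// ge.
have [g ge] := rng_surj (src (alpha e)); rewrite -[g]betaK in ge.
rewrite -((admE (beta g) e).2 ge).
by apply/admE; rewrite ge.
Qed.

Lemma induced_cyl n x y : cyl n (f x) (f y) <-> cyl n x y.
Proof.
have [[beta alphaK betaK] _] := adm.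
rewrite !cylE !top_edgeE /f /=; split=> -[xy0 xy].
  split=> [|i i_n]; first exact/admissible_src.
  exact/(can_inj alphaK)/xy.
split=> [|i i_n]; first exact/admissible_src.
by rewrite /edges /= -/(edges y i) xy.
Qed.

Lemma induced_inverse : exists g : X B' -> X B,
  [/\ cancel f g, cancel g f, forall A, f @` A = g @^-1` A &
      measurable_fun setT g].
Proof.
have [[beta alphaK betaK] admE] := adm.
have admB : admissible beta.
  split=> [|e e']; first by exists alpha.
  by rewrite -{1}[e]betaK -{1}[e']betaK; symmetry; exact: admE.
have fg : cancel (induced_map admB) f.
  by move=> x; apply: edges_inj => n; exact: betaK.
have gf : cancel f (induced_map admB).
  by move=> x; apply: edges_inj => n; exact: alphaK.
exists (induced_map admB); split=> //.
  move=> A; apply/seteqP; split=> [_ [x Ax <-]|y Ay].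
    by rewrite /preimage /= gf.
  by exists (induced_map admB y).
apply: measurable_cyl_map => x n; exists n => y.
by rewrite -induced_cyl !fg.
Qed.

Lemma measurable_image A : measurable A -> measurable (f @` A).
Proof.
have [g [_ _ fE mg]] := induced_inverse => mA.
by rewrite fE -[X in measurable X]setTI; exact: mg.
Qed.

Lemma image_measure (R : realType) (m' : probability (X B') R) :
  exists nu : {measure set (X B) -> \bar R},
  [/\ forall A, nu A = m' (f @` A), nu setT = 1%E &
      forall n x, nu (cyl n x) = m' (cyl n (f x))].
Proof.
have [g [_ gK fE mg]] := induced_inverse.
have [nu nuE] := pushforward_measure m' mg.
exists nu; split=> [A||n x]; first by rewrite nuE fE.
  by rewrite nuE preimage_setT; exact: probability_setT.
rewrite nuE; congr (m' _); apply/seteqP; split=> y /=.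
  by rewrite -induced_cyl gK.
by rewrite -{1}[y]gK induced_cyl.
Qed.

Lemma implements_isomorphismP (R : realType) (m : probability (X B) R)
    (m' : probability (X B') R) :
  implements_isomorphism m m' adm <->
  forall A, measurable A -> m' (f @` A) = 0%E <-> m A = 0%E.
Proof.
have [nu [nuE _ _]] := image_measure m'.
have [[beta alphaK betaK] _] := adm.
split=> [iso A mA|mm' e].
  rewrite -nuE.
  have mAe (e : E B) : measurable (A `&` Rg e).
    by apply: measurableI => //; exact: measurable_edge.
  have isoe e : nu (A `&` Rg e) = 0%E <-> m (A `&` Rg e) = 0%E.
    by rewrite nuE; have [_ + _] := iso e; apply => // x [].
  have null0 (mu1 mu2 : {measure set (X B) -> \bar R}) :
      (forall e, mu1 (A `&` Rg e) = 0%E -> mu2 (A `&` Rg e) = 0%E) ->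
      mu1 A = 0%E -> mu2 A = 0%E.
    move=> mu12 mu1A; rewrite (measure_partition mu2 (f := fun x => edges x 0))//.
    apply: big1 => e _; apply: mu12; apply/eqP; rewrite eq_le measure_ge0 andbT.
    by rewrite -mu1A; apply: le_measure; rewrite ?inE.
  by split; apply: null0 => e /isoe.
split.
- exists set0, set0; rewrite !setD0; split; [exact: negligible_set0..|].
  have [g [fK gK _ _]] := induced_inverse.
  split=> [x <-//|x y _ _ /(can_inj fK)//|y yRg].
  exists (g y) => //=; rewrite /Rg /= -(alphaK (edges (g y) 0)) -[RHS]alphaK.
  by rewrite -yRg -{2}[y]gK.
- by move=> A mA _; exact: mm'.
apply: aeW => x Dx; have Dfx : D (alpha e) (f x) by apply/esym/adm.2; rewrite Dx.
exists Dfx; apply: edges_inj => -[|n] //.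
Qed.

Lemma tail_set_image H : tail_set H -> tail_set (f @` H).
Proof.
have [[beta alphaK _] _] := adm; have [g [fK gK _ _]] := induced_inverse.
move=> tH N x' y xy [x Hx fxE]; rewrite -fxE in xy; exists (g y) => //; apply: tH Hx => i Ni.
by apply: (can_inj alphaK); have := xy i Ni; rewrite -{1}[y]gK.
Qed.

End Transport.

Section Equivalence.
Context {R : realType} {B B' : bratteli}.
Variables (m : probability (X B) R) (m' : probability (X B') R).
Variables (alpha : E B -> E B') (adm : admissible alpha).
Variables (P0 : vertex B -> R) (P : nat -> vertex B -> E B -> R).
Variables (P0' : vertex B' -> R) (P' : nat -> vertex B' -> E B' -> R).
Hypotheses (mP : is_markov m P0 P) (mP' : is_markov m' P0' P').

Let f := induced_map adm.
Let u := weight P0 P.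
Let w n x := weight P0' P' n (f x).

Let ratio x i := P' i (src (alpha (edges x i))) (alpha (edges x i)) /
  P i (src (edges x i)) (edges x i).

Let scale x := P0' (src (alpha (edges x 0))) / P0 (src (edges x 0)).

Let scale_gt0 x : 0 < scale x.
Proof. by have [[P00 _] _ _] := mP; have [[P00' _] _ _] := mP'; rewrite divr_gt0. Qed.

Let u_gt0 n x : 0 < u n x. Proof. exact: weight_gt0 mP. Qed.

Let w_gt0 n x : 0 < w n x. Proof. exact: weight_gt0 mP'. Qed.

Let weight_ratio n x : w n x / u n x = scale x * \prod_(i < n) ratio x i.
Proof. by rewrite /w /u /weight /scale /ratio prodf_div mulf_div. Qed.

Let mu_cyl n x : m (cyl n x) = (u n x)%:E. Proof. exact: markov_cyl mP. Qed.

Let mT : (m setT < +oo)%E. Proof. by rewrite probability_setT ltry. Qed.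

Lemma inf_prod_of_null :
  (forall A, measurable A -> m' (f @` A) = 0%E -> m A = 0%E) ->
  {ae m, forall x, inf_prod_pos (ratio x)}.
Proof.
move=> m'm; have [nu [nuE nuT nuC]] := image_measure adm m'.
have nu_cyl n x : nu (cyl n x) = (w n x)%:E by rewrite nuC (markov_cyl _ _ mP').
have nuToo : (nu setT < +oo)%E by rewrite nuT ltry.
have num A : measurable A -> nu A = 0%E -> m A = 0%E by rewrite nuE; exact: m'm.
apply: filterS (density_cvg mT nuToo u_gt0 w_gt0 mu_cyl nu_cyl num).
move=> x [l l0 zl]; exists (l / scale x); first by rewrite divr_gt0.
have -> : (fun n => \prod_(i < n) ratio x i) = (fun n => w n x / u n x / scale x).
  by apply/funext => n; rewrite weight_ratio mulrC mulKf// gt_eqF.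
exact: cvgMl zl.
Qed.

Lemma null_iff_of_inf_prod :
  (exists Q0 Q, bounded_markov m' Q0 Q) -> {ae m, forall x, inf_prod_pos (ratio x)} ->
  forall A, measurable A -> m' (f @` A) = 0%E <-> m A = 0%E.
Proof.
move=> [Q0 [Q m'Q]] ratio_ae; have [nu [nuE nuT nuC]] := image_measure adm m'.
have nu_cyl n x : nu (cyl n x) = (w n x)%:E by rewrite nuC (markov_cyl _ _ mP').
have nuToo : (nu setT < +oo)%E by rewrite nuT ltry.
have bounded_quotient (a b : nat -> R) (l : R) : (forall n, 0 < a n) -> (forall n, 0 < b n) ->
    0 < l -> (fun n => a n / b n) @ \oo --> l ->
    exists K : nat, forall n, (K <= n)%N -> b n <= K%:R * a n.
  move=> a0 b0 l0 abl.
  have [d d0 dP] := cvg_pos_lb (fun n => divr_gt0 (a0 n) (b0 n)) l0 abl.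
  exists (Num.truncn d^-1).+1 => n _.
  apply: (@le_trans _ _ (d^-1 * a n)).
    by have := dP n; rewrite ler_pdivlMr// ler_pdivlMl.
  by rewrite ler_pM2r// ltW// truncnS_gt.
pose H := bounded_density u w `&` bounded_density w u.
have mHw : measurable (bounded_density u w) by exact: measurable_bounded_density mu_cyl nu_cyl.
have mHu : measurable (bounded_density w u) by exact: measurable_bounded_density nu_cyl mu_cyl.
have mH : measurable H by exact: measurableI.
have mHC : m (~` H) = 0%E.
  apply/negligibleP; first exact: measurableC.
  apply: negligibleS ratio_ae => x nHx [l l0 pl]; apply: nHx.
  have zl : (fun n => w n x / u n x) @ \oo --> scale x * l.
    under eq_fun do rewrite weight_ratio.
    exact: cvgMr pl.
  have sl0 : 0 < scale x * l by rewrite mulr_gt0.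
  split; last exact: bounded_quotient zl.
  apply: (@bounded_quotient _ _ (scale x * l)^-1) => //; first by rewrite invr_gt0.
  under eq_fun do rewrite -invf_div.
  by apply: cvgV => //; rewrite gt_eqF.
have wT N n x y : (N <= n)%N -> (forall i, (N <= i)%N -> edges x i = edges y i) ->
    w n x * w N y = w n y * w N x.
  by move=> Nn xy; apply: weight_tail => // i Ni; rewrite /edges /= -/(edges x i) xy.
have uT N n x y := @weight_tail _ _ P0 P N n x y.
have tH : tail_set H.
  move=> N x y xy [Hw Hu]; split.
    by apply: (tail_set_bounded_density _ _ uT wT xy).
  by apply: (tail_set_bounded_density _ _ wT uT xy).
have subC (S T : set (X B)) (mu : {measure set (X B) -> \bar R}) :
    measurable S -> measurable T -> S `<=` T -> mu (~` S) = 0%E -> mu (~` T) = 0%E.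
  move=> mS mT' ST muS; apply/eqP; rewrite eq_le measure_ge0 andbT -muS.
  by apply: le_measure; rewrite ?inE; [exact: measurableC..|exact: subsetC].
have nuH : (0 < m' (f @` H))%E.
  rewrite lt0e measure_ge0 andbT -nuE; apply/eqP => nuH0.
  have mH0 : m H = 0%E.
    apply: (null_of_bounded_density nuToo nu_cyl mu_cyl) => //.
    by apply: (subC H _ m) => // x [].
  have := probability_setC m mH; rewrite mHC mH0 sube0 => /eqP.
  by rewrite eqe eq_sym oner_eq0.
have nuHC : nu (~` H) = 0%E.
  apply/eqP; rewrite eq_le measure_ge0 andbT nuE.
  rewrite -(zero_one_law m'Q (measurable_image adm mH) (tail_set_image tH) nuH).
  apply: le_measure; rewrite ?inE.
  - by apply: measurable_image; exact: measurableC.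
  - by apply: measurableC; exact: measurable_image.
  have [g [fK _ _ _]] := induced_inverse adm.
  by move=> _ [x nHx <-] [y Hy /(can_inj fK) yx]; apply: nHx; rewrite -yx.
move=> A mA; rewrite -nuE; split.
  apply: (null_of_bounded_density nuToo nu_cyl mu_cyl) => //.
  by apply: (subC H _ m) => // x [].
apply: (null_of_bounded_density mT mu_cyl nu_cyl) => //.
by apply: (subC H) => // x [].
Qed.

End Equivalence.

Theorem theorem4p9 (R : realType) (B B' : bratteli)
    (m : probability (X B) R) (m' : probability (X B') R)
    (m_non_atomic : non_atomic m) (m'_non_atomic : non_atomic m')
    (m_kind : measure_in_claim m) (m'_kind : measure_in_claim m')
    (alpha : E B -> E B') (adm : admissible alpha) :
  implements_isomorphism m m' adm <->
  [\/ [/\ tail_invariant m, tail_invariant m' &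
          forall A : set (X B), measurable A -> m' (induced_map adm @` A) = m A],
      exists P0 p P0' p',
        [/\ is_stationary_markov m P0 p, is_stationary_markov m' P0' p' &
            forall e : E B, p' (src (alpha e)) (alpha e) = p (src e) e] |
      exists P0 P P0' P',
        [/\ is_markov m P0 P, is_markov m' P0' P' &
            {ae m, forall x : X B, inf_prod_pos (fun i =>
               P' i (src (alpha (edges x i))) (alpha (edges x i)) /
               P i (src (edges x i)) (edges x i))}]].
Proof.
rewrite implements_isomorphismP; split=> [mm'|].
  have [P0 [P [mP _]]] := claim_bounded m_kind.
  have [P0' [P' [mP' _]]] := claim_bounded m'_kind.
  apply: Or33; exists P0, P, P0', P'; split=> //.
  exact: (inf_prod_of_null mP mP' (fun A mA => (mm' A mA).1)).
have m'_bounded := claim_bounded m'_kind.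
case=> [[_ _ mm' A /mm' -> //]|[P0 [p [P0' [p' [mp mp' pp']]]]]
  |[P0 [P [P0' [P' [mP mP' PP']]]]]]; last exact: null_iff_of_inf_prod mP mP' _ PP'.
have ratio1 : {ae m, forall x : X B, inf_prod_pos (fun i =>
    p' (src (alpha (edges x i))) (alpha (edges x i)) /
    p (src (edges x i)) (edges x i))}.
  apply: aeW => x; exists 1 => //.
  rewrite (_ : (fun n => _) = cst 1); first exact: cvg_cst.
  apply/funext => n; apply: big1 => i _; rewrite pp' divff// gt_eqF//.
  exact: (markov_transition_gt0 0 _ mp).
exact: null_iff_of_inf_prod mp mp' m'_bounded ratio1.
Qed.
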